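(* The invasion percolation cluster (IPC) of the origin on the square lattice $\mathbb{Z}^2$ is not stochastically dominated by the incipient infinite cluster (IIC) of the origin on $\mathbb{Z}^2$. That is, there is no coupling of the two random subgraphs such that the IIC contains the IPC with probability $1$: there do not exist a probability space and random subgraphs $I$ and $J$ of $\mathbb{Z}^2$ defined on it such that $I$ has the law of the IPC, $J$ has the law of the IIC, and $I$ is a subgraph of $J$ with probability $1$.
   Context: **Lattice.** $\mathbb{Z}^2$ denotes the square lattice graph with vertex set $\mathbb{Z}^2$ and (undirected) edge set $\mathbb{E}^2=\{(x,y)\in\mathbb{Z}^2\times\mathbb{Z}^2 : |x-y|=1\}$ (nearest-neighbour edges, Euclidean distance $1$). The origin is $0=(0,0)$. For an integer $n\ge 1$, $\mathrm{B}(n)=[-n,n]^2$ is the $l^\infty$-ball of radius $n$ centered at the origin (as a set of lattice vertices), and $\partial \mathrm{B}(n)=\mathrm{B}(n)\setminus \mathrm{B}(n-1)$. **Invasion percolation cluster (IPC).** Let $(\tau_e)_{e\in\mathbb{E}^2}$ be independent random variables, uniform on $[0,1]$ (almost surely pairwise distinct). Define an increasing sequence $G_n=(V_n,E_n)$ of finite connected subgraphs of $\mathbb{Z}^2$: $G_0$ consists of the origin only ($V_0=\{0\}$, $E_0=\emptyset$). Given $G_n=(V_n,E_n)$, the set $E_{n+1}$ is obtained from $E_n$ by adding the edge with the smallest weight $\tau_e$ among all edges in $\{(x,y)\in\mathbb{E}^2\setminus E_n : x\in V_n,\ y\in\mathbb{Z}^2\}$, and $G_{n+1}$ is the graph induced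 by the edge set $E_{n+1}$ (its vertices are the endpoints of the edges in $E_{n+1}$). The IPC is the random infinite connected subgraph $\bigcup_{n\ge 0} G_n$. **Bernoulli bond percolation.** For $p\in[0,1]$, $\mathbb{P}_p$ is the product measure on $\{0,1\}^{\mathbb{E}^2}$ (with the $\sigma$-field generated by finite-dimensional cylinders) under which each edge $e$ is open ($\omega_e=1$) with probability $p$ and closed ($\omega_e=0$) with probability $1-p$, independently. For vertex sets $S_1,S_2$, $S_1\leftrightarrow S_2$ is the event that some vertex of $S_1$ is connected to some vertex of $S_2$ by a path of open edges; a singleton $\{x\}$ is written $x$. Let $\theta(p)$ be the $\mathbb{P}_p$-probability that the open cluster of the origin is infinite. The critical probability $p_c\in(0,1)$ is the number such that $\theta(p)>0$ if and only if $p>p_c$. **Incipient infinite cluster (IIC).** By a theorem of Kesten, for every event $\mathcal{E}$ depending on the states of finitely many edges the limit $$\nu[\mathcal{E}]=\lim_{N\to\infty}\mathbb{P}_{p_c}\left[\mathcal{E}\,\middle|\,0\leftrightarrow\partial \mathrm{B}(N)\right]$$ exists, and $\nu$ extends uniquely to a probability measure on $\{0,1\}^{\mathbb{E}^2}$. Under $\nu$ the open cluster of the origin is almost surely infinite. The IIC is this open cluster of the origin under $\nu$, regarded as a random subgraph of $\mathbb{Z}^2$: its vertices are those connected to $0$ by open paths, and its edges are the open edges between such vertices. The laws of the IPC and the IIC are regarded as probability measures on the set of subgraphs of $\mathbb{Z}^2$ (with the $\sigma$-field generated by the events that a given vertex or edge belongs to the subgraph). *)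

(* Defs.v *)
From HB Require Import structures.
From mathcomp Require Import all_boot all_order all_algebra.
From mathcomp Require Import all_classical all_reals all_analysis.

Set Implicit Arguments.
Unset Strict Implicit.
Unset Printing Implicit Defensive.

Import Order.TTheory GRing.Theory Num.Theory.
Import numFieldNormedType.Exports.

Local Open Scope classical_set_scope.
Local Open Scope ring_scope.

Definition vertex : Type := (int * int)%type.

Definition origin : vertex := (0, 0).

(* (x, false) is the undirected edge {x, x + (1,0)} and (x, true) is the
   undirected edge {x, x + (0,1)}; every nearest-neighbour edge of Z^2 is
   represented exactly once. *)
Definition edge : Type := (vertex * bool)%type.

Definition edge_src (e : edge) : vertex := e.1.
Definition edge_tgt (e : edge) : vertex :=
  if e.2 then (e.1.1, e.1.2 + 1) else (e.1.1 + 1, e.1.2).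

Definition endpoint (e : edge) (x : vertex) : Prop :=
  x = edge_src e \/ x = edge_tgt e.

Definition joins (e : edge) (x y : vertex) : Prop :=
  (x = edge_src e /\ y = edge_tgt e) \/ (x = edge_tgt e /\ y = edge_src e).

Record graph := Graph {
  vset : set vertex ;
  eset : set edge ;
  graphP : forall e x, eset e -> endpoint e x -> vset x }.

Definition origin_graph : graph :=
  @Graph [set origin] set0 (fun _ _ (h : False) _ => False_ind _ h).

HB.instance Definition _ := gen_eqMixin graph.
HB.instance Definition _ := gen_choiceMixin graph.
HB.instance Definition _ := isPointed.Build graph origin_graph.

Definition subgraph_of (g h : graph) : Prop :=
  vset g `<=` vset h /\ eset g `<=` eset h.

Definition graph_events : set (set graph) :=
  range (fun x : vertex => [set g | vset g x]) `|`
  range (fun e : edge => [set g | eset g e]).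

Definition subgraph := g_sigma_algebraType graph_events.

Lemma induced_graphP (E : set edge) e x :
  E e -> endpoint e x -> [set y | exists2 f, E f & endpoint f y] x.
Proof. by move=> Ee ex; exists e. Qed.

Definition induced_graph (E : set edge) : graph := Graph (@induced_graphP E).

Definition outer_edges (g : graph) : set edge :=
  [set e | ~ eset g e /\ exists2 x, vset g x & endpoint e x].

(* When the weights are pairwise distinct, the set below is a singleton for
   every finite nonempty [g]; [xget] only resolves ties, an event of
   probability zero in the model. *)
Definition next_edge (R : realType) (t : edge -> R) (g : graph) : edge :=
  xget (origin, false)
    [set e | outer_edges g e /\ forall f, outer_edges g f -> t e <= t f].

Fixpoint invasion (R : realType) (t : edge -> R) (n : nat) : graph :=
  if n is m.+1 then
    let g := invasion t m in induced_graph (eset g `|` [set next_edge t g])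
  else origin_graph.

Lemma invasion_unionP (R : realType) (t : edge -> R) e x :
  (\bigcup_n eset (invasion t n)) e -> endpoint e x ->
  (\bigcup_n vset (invasion t n)) x.
Proof. by move=> [n _ ne] ex; exists n => //; exact: graphP ex. Qed.

Definition invasion_cluster (R : realType) (t : edge -> R) : subgraph :=
  Graph (@invasion_unionP R t).

Definition iid_uniform (R : realType) (d : measure_display)
    (T : measurableType d) (P : probability T R)
    (tau : edge -> {RV P >-> R}) : Prop :=
  (forall (e : edge) (B : set R), measurable B ->
     distribution P (tau e) B = uniform_prob (@ltr01 R) B) /\
  (forall (s : seq edge) (B : edge -> set R), uniq s ->
     (forall e, measurable (B e)) ->
     P [set w | forall e, e \in s -> B e (tau e w)] =
     (\prod_(e <- s) P (tau e @^-1` B e))%E).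

Definition coordinate_events : set (set (edge -> bool)) :=
  range (fun e : edge => [set w : edge -> bool | w e]).

Definition config := g_sigma_algebraType coordinate_events.

Definition open_edge (w : config) (e : edge) : bool := w e.

Definition bernoulli_percolation (R : realType) (p : R)
    (mu : probability config R) : Prop :=
  forall (s : seq edge) (a : edge -> bool), uniq s ->
    mu [set w | forall e, e \in s -> open_edge w e = a e] =
    (\prod_(e <- s) bernoulli_pmf p (a e))%:E.

Definition open_step (w : config) : rel vertex :=
  fun x y => `[< exists2 e, open_edge w e & joins e x y >].

Definition connected (w : config) (x y : vertex) : Prop :=
  exists2 s : seq vertex, path (open_step w) x s & last x s = y.

Definition connects (S1 S2 : set vertex) : set config :=
  [set w | exists x y, [/\ S1 x, S2 y & connected w x y]].

Definition open_cluster (w : config) : set vertex :=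
  [set x | connected w origin x].

Definition box (n : nat) : set vertex :=
  [set x | `|x.1| <= n%:Z /\ `|x.2| <= n%:Z].

(* The usual vertex boundary for n >= 1 (and empty for n = 0). *)
Definition box_boundary (n : nat) : set vertex := box n `\` box n.-1.

Definition theta (R : realType) (mu : probability config R) : \bar R :=
  mu [set w | infinite_set (open_cluster w)].

Definition critical_probability (R : realType)
    (Pp : R -> probability config R) (pc : R) : Prop :=
  0 < pc < 1 /\
  forall p : R, 0 <= p <= 1 -> ((0 < theta (Pp p))%E <-> pc < p).

Definition finitely_determined (A : set config) : Prop :=
  exists s : seq edge, forall w w' : config,
    (forall e, e \in s -> open_edge w e = open_edge w' e) -> A w -> A w'.

Definition cond_prob (R : realType) (mu : probability config R)
    (A B : set config) : R := fine (mu (A `&` B)) / fine (mu B).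

(* [mu] is percolation at criticality. A probability measure [nu] with this
   property is unique, since the finitely determined events form a
   pi-system that generates the sigma-algebra of [config]. *)
Definition iic_measure (R : realType) (mu nu : probability config R) : Prop :=
  forall A : set config, finitely_determined A ->
    cond_prob mu A (connects [set origin] (box_boundary N))
      @[N --> \oo] --> fine (nu A).

Lemma cluster_graphP (w : config) e x :
  [set f | open_edge w f /\ forall y, endpoint f y -> open_cluster w y] e ->
  endpoint e x -> open_cluster w x.
Proof. by move=> [_ h]; exact: h. Qed.

Definition cluster_graph (w : config) : subgraph := Graph (@cluster_graphP w).

Definition has_law_of (R : realType) (d d' : measure_display)
    (T : measurableType d) (T' : measurableType d') (P : probability T R)
    (X : {RV P >-> subgraph}) (Q : probability T' R) (Y : T' -> subgraph)
    : Prop :=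
  forall A : set subgraph, measurable A ->
    distribution P X A = Q (Y @^-1` A).

(* Main.v *)
(* Compare the probabilities that the cluster contains all edges of a large
   square grid with corner at the origin, say with n steps per side.

   Split the edges of the grid into a spanning tree (the comb) and the n^2
   remaining edges (the rungs). Given that the comb is open, the rungs join
   vertices that are already connected, so they are independent of the event
   that the origin is connected to a distant box boundary. Hence the IIC
   contains the grid with probability at most pc^(n^2).

   If all the 2n(n+1) edges of the grid have weight at most q and all the 4(n+1)
   edges leaving the grid (the frame) have weight above q, then the invasion
   fills the grid before leaving it. Hence the IPC contains the grid with
   probability at least q^(2n(n+1)) (1-q)^(4(n+1)), whatever q in [0,1].

   When q^2 > pc the second bound exceeds the first for large n. *)
Require Import Defs.
From mathcomp Require Import all_boot all_order all_algebra.
From mathcomp Require Import zify lra.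
From mathcomp Require Import all_classical all_reals all_analysis.
Import Order.TTheory GRing.Theory Num.Theory.
Local Open Scope classical_set_scope.
Local Open Scope ring_scope.

(** * The grid, its spanning comb and its frame *)

Definition gpt (i j : nat) : vertex := (i%:Z, j%:Z).
Definition hor (i j : nat) : edge := (gpt i j, false).
Definition ver (i j : nat) : edge := (gpt i j, true).

(** The bottom row is the spine, the [n.+1] columns are the teeth. *)
Definition comb (n : nat) : seq edge :=
  [seq hor i 0 | i <- iota 0 n] ++
  [seq ver i j | i <- iota 0 n.+1, j <- iota 0 n].
Definition rungs (n : nat) : seq edge :=
  [seq hor i j | i <- iota 0 n, j <- iota 1 n].
Definition grid (n : nat) : seq edge := comb n ++ rungs n.

(** Left, right, bottom and top sides, in this order. With the grid, these are all the edges that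
    touch a grid vertex. *)
Definition frame (n : nat) : seq edge :=
  [seq ((-1, j%:Z), false) | j <- iota 0 n.+1] ++
  [seq hor n j | j <- iota 0 n.+1] ++
  [seq ((i%:Z, -1), true) | i <- iota 0 n.+1] ++
  [seq ver i n | i <- iota 0 n.+1].

Lemma mem_comb (n : nat) (x y : int) (b : bool) :
  ((x, y, b) \in comb n) =
  if b then (0 <= x <= n%:Z) && (0 <= y < n%:Z)
  else (0 <= x < n%:Z) && (y == 0).
Proof.
rewrite mem_cat; apply/idP/idP.
  case/orP => [/mapP[i]|/allpairsP[[i j] []]].
    by rewrite mem_iota => hi [-> -> ->] /=; lia.
  by rewrite !mem_iota => /= hi hj [-> -> ->] /=; lia.
case: b => /andP[hx hy]; apply/orP.
  right; apply/allpairsP; exists (`|x|%N, `|y|%N).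
  by rewrite !mem_iota; split=> /=; [lia|lia|congr (_, _, _); lia].
left; apply/mapP; exists `|x|%N; first by rewrite mem_iota; lia.
by congr (_, _, _); lia.
Qed.

Lemma mem_rungs (n : nat) (x y : int) (b : bool) :
  ((x, y, b) \in rungs n) = [&& ~~ b, 0 <= x < n%:Z & 1 <= y <= n%:Z].
Proof.
apply/idP/idP.
  case/allpairsP => [[i j] []].
  by rewrite !mem_iota => /= hi hj [-> -> ->] /=; lia.
case/and3P => /negPf -> hx hy.
apply/allpairsP; exists (`|x|%N, `|y|%N).
by rewrite !mem_iota; split=> /=; [lia|lia|congr (_, _, _); lia].
Qed.

Lemma mem_grid (n : nat) (x y : int) (b : bool) :
  ((x, y, b) \in grid n) =
  if b then (0 <= x <= n%:Z) && (0 <= y < n%:Z)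
  else (0 <= x < n%:Z) && (0 <= y <= n%:Z).
Proof. by rewrite mem_cat mem_comb mem_rungs; case: b => /=; lia. Qed.

Lemma mem_frame (n : nat) (x y : int) (b : bool) :
  ((x, y, b) \in frame n) =
  if b then (0 <= x <= n%:Z) && ((y == -1) || (y == n%:Z))
  else ((x == -1) || (x == n%:Z)) && (0 <= y <= n%:Z).
Proof.
rewrite !mem_cat; apply/idP/idP.
  by case/or4P => /mapP[i]; rewrite mem_iota => hi [-> -> ->] /=; lia.
case: b.
  case/andP => hx /orP[] /eqP->; apply/or4P; [apply: Or43|apply: Or44];
    apply/mapP; exists `|x|%N; rewrite ?mem_iota; try lia;
    by congr (_, _, _); lia.
case/andP => /orP[] /eqP-> hy; apply/or4P; [apply: Or41|apply: Or42];
  apply/mapP; exists `|y|%N; rewrite ?mem_iota; try lia;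
  by congr (_, _, _); lia.
Qed.

Lemma uniq_grid (n : nat) : uniq (grid n).
Proof.
rewrite cat_uniq; apply/and3P; split.
- rewrite cat_uniq; apply/and3P; split.
  + by rewrite map_inj_uniq ?iota_uniq// => i j [].
  + apply/hasPn => _ /allpairsP[[i j]/=[_ _ ->]].
    by apply/negP => /mapP[k _ []].
  + apply: allpairs_uniq; rewrite ?iota_uniq//.
    by move=> [i j] [i' j'] _ _ [-> ->].
- apply/hasPn => -[[x y] b]; rewrite /= mem_rungs mem_comb.
  by case: b => //=; lia.
- apply: allpairs_uniq; rewrite ?iota_uniq//.
  by move=> [i j] [i' j'] _ _ [-> ->].
Qed.

Lemma uniq_grid_frame (n : nat) : uniq (grid n ++ frame n).
Proof.
rewrite cat_uniq uniq_grid andTb; apply/andP; split.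
  apply/hasPn => -[[x y] b]; rewrite /= mem_grid mem_frame.
  by case: b => /=; lia.
have injm (T : eqType) (f : nat -> T) : injective f -> uniq (map f (iota 0 n.+1)).
  by move=> fi; rewrite map_inj_uniq// iota_uniq.
rewrite !cat_uniq !injm; try by [move=> i j []].
rewrite ?andbT ?andTb; apply/and3P; split; apply/hasPn => -[[x y] b];
  rewrite ?mem_cat.
- case/or3P => /mapP[i _ [-> -> ->]]; apply/negP => /mapP[j _ []] //.
- case/orP => /mapP[i _ [-> -> ->]]; apply/negP => /mapP[j _ []] //.
- by case/mapP=> i _ [-> -> ->]; apply/negP => /mapP[j _ []].
Qed.

Lemma size_grid (n : nat) : size (grid n) = (2 * n * n.+1)%N.
Proof.
by rewrite !size_cat !size_map !size_allpairs !size_iota; lia.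
Qed.

Lemma size_rungs (n : nat) : size (rungs n) = (n * n)%N.
Proof. by rewrite size_allpairs !size_iota. Qed.

Lemma size_frame (n : nat) : size (frame n) = (4 * n.+1)%N.
Proof. by rewrite !size_cat !size_map !size_iota; lia. Qed.

Lemma grid_endpoint (n : nat) (e : edge) (x : vertex) :
  e \in grid n -> endpoint e x ->
  exists i j : nat, [/\ (i <= n)%N, (j <= n)%N & x = gpt i j].
Proof.
case: e => [[a b] c]; rewrite mem_grid => h [] ->; rewrite /edge_src /edge_tgt /=.
  exists `|a|%N, `|b|%N.
  by case: c h => h; split; try lia; congr (_, _); lia.
case: c h => h.
  by exists `|a|%N, (absz (b + 1)); split; try lia; congr (_, _); lia.
by exists (absz (a + 1)), `|b|%N; split; try lia; congr (_, _); lia.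
Qed.

Lemma grid_frame_incident (n i j : nat) (e : edge) :
  (i <= n)%N -> (j <= n)%N -> endpoint e (gpt i j) ->
  e \in grid n ++ frame n.
Proof.
case: e => [[a b] c] hi hj; rewrite mem_cat mem_grid mem_frame /endpoint.
by rewrite /edge_src /edge_tgt /gpt /=; case: c => -[] [h1 h2]; lia.
Qed.

(** Walk along the bottom row to column [i], then up that column. This serves both the spread of the
    invasion and open connections from the origin. *)
Lemma comb_ind (n : nat) (W : vertex -> Prop) :
  W origin ->
  (forall e x y, e \in comb n -> joins e x y -> W x -> W y) ->
  forall i j : nat, (i <= n)%N -> (j <= n)%N -> W (gpt i j).
Proof.
move=> W0 Wstep i j hi; elim: j => [_|j IH hj].
  elim: i hi => [//|i IH hi]; apply: (Wstep (hor i 0)) (IH (ltnW hi)).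
    by rewrite mem_comb; lia.
  by left; split=> //; congr (_, _); rewrite /=; lia.
apply: (Wstep (ver i j)) (IH (ltnW hj)).
  by rewrite mem_comb; lia.
by left; split=> //; congr (_, _); rewrite /=; lia.
Qed.

Lemma joins_endpoint (e : edge) (x y : vertex) :
  joins e x y -> endpoint e x /\ endpoint e y.
Proof. by move=> [] [-> ->]; split; [left|right|right|left]. Qed.

(** * Invasion of a light grid inside a heavy frame *)

Lemma ex_seq_min (R : realType) (T : eqType) (t : T -> R) (x : T) (s : seq T) :
  x \in s -> exists2 e, e \in s & forall f, f \in s -> t e <= t f.
Proof.
elim: s x => [//|y s IH] x _; case: s IH => [|z s] IH.
  by exists y; [rewrite inE|move=> f; rewrite inE => /eqP->].
have [e es emin] := IH z (mem_head _ _).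
have [h|h] := leP (t y) (t e).
  exists y; first exact: mem_head.
  by move=> f /predU1P[->//|/emin]; exact: le_trans.
exists e; first by rewrite inE es orbT.
by move=> f /predU1P[->|/emin//]; exact: ltW.
Qed.

(* As long as some edge of the grid touches the invaded region, it is lighter
   than every edge of the frame, so the invasion cannot leave the grid. *)
Lemma invasion_fills_grid (R : realType) (t : edge -> R) (q : R) (n : nat) :
  (forall e, e \in grid n -> t e <= q) ->
  (forall e, e \in frame n -> q < t e) ->
  exists k : nat, forall e, e \in grid n -> eset (invasion t k) e.
Proof.
move=> tgrid tframe; apply: contrapT => nfull.
(* Counting argument: if the grid is never filled, then the first [k] steps invade [k] distinct grid
   edges for every [k], which fails once [k] exceeds the size of the grid. *)
suff H (k : nat) : exists l : seq edge,
    [/\ uniq l, size l = k, {subset l <= grid n},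
        (forall e, eset (invasion t k) e <-> e \in l) &
        vset (invasion t k) origin /\
        (forall x, vset (invasion t k) x ->
          exists i j : nat, [/\ (i <= n)%N, (j <= n)%N & x = gpt i j])].
  have [l [ul sl lg _ _]] := H (size (grid n)).+1.
  by have := uniq_leq_size ul lg; rewrite sl ltnn.
elim: k => [|k [l [ul sl lg lE [v0 vg]]]].
  exists [::]; split=> //; split=> // x ->.
  by exists 0%N, 0%N.
pose g := invasion t k.
(* Otherwise every grid edge that touches the invaded region is already invaded. Following the comb,
   the region then contains all grid vertices, hence all grid edges, against [nfull]. *)
have [f [fg fo]] : exists f, f \in grid n /\ outer_edges g f.
  apply: contrapT => nf; apply: nfull; exists k => e eg.
  have inW f x : f \in grid n -> vset g x -> endpoint f x -> eset g f.
    move=> fg vx ex; apply: contrapT => nef; apply: nf; exists f.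
    by split=> //; split=> //; exists x.
  have vW : forall i j : nat, (i <= n)%N -> (j <= n)%N -> vset g (gpt i j).
    apply: comb_ind => // f x y fc fxy vx.
    have [fx fy] := joins_endpoint _ _ _ fxy.
    apply: graphP fy; apply: inW vx fx.
    by rewrite mem_cat fc.
  have esrc : endpoint e (edge_src e) by left.
  have [i [j [hi hj eij]]] := grid_endpoint _ _ _ eg esrc.
  by apply: (inW e (edge_src e)) => //; rewrite eij; exact: vW.
have outer_gf e : outer_edges g e -> e \in grid n ++ frame n.
  move=> [_ [x vx ex]]; have [i [j [hi hj xij]]] := vg x vx.
  by apply: (grid_frame_incident n i j) => //; rewrite -xij.
(* The [xget] in [next_edge] is meaningful only if a minimiser exists. A lightest outer grid edge is
   one, because the other outer edges lie in the frame and are heavier than [q]. *)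
have [next_out next_min] : [set e | outer_edges g e /\
    forall f, outer_edges g f -> t e <= t f] (next_edge t g).
  have [|e0] := ex_seq_min R _ t f [seq e <- grid n | `[< outer_edges g e >]].
    by rewrite mem_filter fg andbT; apply/asboolP.
  rewrite mem_filter => /andP[/asboolP oe0 e0g] e0min.
  apply: (@xgetPex _ (origin, false)); exists e0; split=> // e oe.
  have := outer_gf e oe; rewrite mem_cat => /orP[eg|ef].
    by apply: e0min; rewrite mem_filter eg andbT; apply/asboolP.
  by apply/ltW/(le_lt_trans (tgrid _ e0g)); exact: tframe.
have next_grid : next_edge t g \in grid n.
  have := outer_gf _ next_out; rewrite mem_cat => /orP[//|/tframe].
  by rewrite ltNge (le_trans (next_min f fo)) ?tgrid.
exists (next_edge t g :: l); split.
- by rewrite /= ul andbT; apply/negP => /lE; case: next_out.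
- by rewrite /= sl.
- by move=> e; rewrite inE => /predU1P[->//|/lg].
- move=> e; rewrite inE /=; split.
    by case=> [/lE ->|->]; rewrite ?orbT ?eqxx.
  by case/predU1P => [->|/lE]; [right|left].
(* Each step rebuilds the vertices from the edges. The only delicate case is step 0, where the
   origin has no edge yet; it is kept because the first edge touches it. *)
have v_mono : vset g `<=` vset (invasion t k.+1).
  move=> x vx; case: k @g {ul sl lg lE v0 vg fg fo outer_gf next_min next_grid}
    next_out vx => [|k] g [_ [y vy ey]] vx.
    by exists (next_edge t g); [right|rewrite vx -vy].
  by case: vx => e ee ex; exists e => //; left.
split=> [|x [e ee ex]]; first exact: v_mono.
apply: (grid_endpoint n e x) => //.
by case: ee => [/lE/lg|->].
Qed.

(** * Locality of the invasion *)

Definition star (x : vertex) : seq edge :=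
  [:: (x, true); (x, false); ((x.1 - 1, x.2), false); ((x.1, x.2 - 1), true)].

Lemma mem_star (e : edge) (x : vertex) : endpoint e x -> e \in star x.
Proof.
case: e => [[a b] c]; rewrite /endpoint /edge_src /edge_tgt !inE /= => -[] -> /=.
  by rewrite !xpair_eqE !eqxx; case: c.
by case: c => /=; rewrite !xpair_eqE !addrK !eqxx ?orbT.
Qed.

(** A step adds one edge, so whatever the weights, [k] steps stay within a fixed finite region. The
    second clause covers the edges to be compared at the next step. *)
Lemma invasion_confined (R : realType) (k : nat) : exists s : seq edge,
  forall t : edge -> R,
    (forall e, eset (invasion t k) e -> e \in s) /\
    (forall e x, vset (invasion t k) x -> endpoint e x -> e \in s).
Proof.
elim: k => [|k [s sP]].
  by exists (star origin) => t; split=> // e x ->; exact: mem_star.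
(* [(origin, false)] is the default value of [next_edge]. *)
pose s1 := (origin, false) :: s.
pose s2 := flatten [seq star (edge_src e) ++ star (edge_tgt e) | e <- s1].
exists (s1 ++ s2) => t; have [sE sV] := sP t.
have nextP : next_edge t (invasion t k) \in s1.
  rewrite /next_edge; case: xgetP => [e _ [[_ [x vx ex]] _]|_].
    by rewrite inE (sV e x) ?orbT.
  exact: mem_head.
have E1 e : eset (invasion t k.+1) e -> e \in s1.
  by case=> [/sE es|->//]; rewrite inE es orbT.
split=> [e /E1 e1|e x [f /E1 f1 fx] ex]; rewrite mem_cat ?e1//.
apply/orP; right; apply/flattenP.
exists (star (edge_src f) ++ star (edge_tgt f)).
  by apply: (map_f (fun f => star (edge_src f) ++ star (edge_tgt f))).
rewrite mem_cat; apply/orP.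
by case: fx => <-; [left|right]; exact: mem_star.
Qed.

(** The algorithm uses the weights only through comparisons, and finitely many edges matter up to
    step [k]. The sets of minimisers coincide, so [xget] makes the same choice even when there are
    ties. *)
Lemma invasion_local (R : realType) (k : nat) : exists s : seq edge,
  forall t t' : edge -> R,
    (forall e f, e \in s -> f \in s -> (t e <= t f) = (t' e <= t' f)) ->
    invasion t k = invasion t' k.
Proof.
elim: k => [|k [s sP]]; first by exists [::].
have [s' s'P] := invasion_confined R k.
exists (s ++ s') => t t' tt' /=.
have -> : invasion t' k = invasion t k.
  by apply/esym/sP => e f es fs; apply: tt'; rewrite mem_cat ?es ?fs.
suff -> : next_edge t (invasion t k) = next_edge t' (invasion t k) by [].
have os' e : outer_edges (invasion t k) e -> e \in s ++ s'.
  move=> [_ [x vx ex]]; have [_ sV] := s'P t.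
  by rewrite mem_cat (sV e x vx ex) orbT.
congr (xget _ _); apply/seteqP; split=> e [oe emin]; split=> // f of_;
  [rewrite -tt'|rewrite tt']; by [apply: emin|apply: os'].
Qed.

(** * Measurability of connection events *)

Lemma measurable_forall_in (d : measure_display) (T : measurableType d)
    (U : eqType) (s : seq U) (F : U -> set T) :
  (forall u, u \in s -> measurable (F u)) ->
  measurable [set w | forall u, u \in s -> F u w].
Proof.
elim: s => [|u s IH] mF.
  by rewrite (_ : [set _ | _] = setT)//; apply/seteqP; split.
rewrite (_ : [set _ | _] = F u `&` [set w | forall v, v \in s -> F v w]).
  apply: measurableI; first exact/mF/mem_head.
  by apply: IH => v vs; apply: mF; rewrite inE vs orbT.
apply/seteqP; split=> [w h|w [h1 h2] v /predU1P[->//|/h2//]].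
by split; [apply/h/mem_head|move=> v vs; apply: h; rewrite inE vs orbT].
Qed.

Lemma measurable_exists (d : measure_display) (T : measurableType d)
    (U : countType) (F : U -> set T) :
  (forall u, measurable (F u)) -> measurable [set w | exists u, F u w].
Proof.
move=> mF; rewrite (_ : [set _ | _] = \bigcup_u F u).
  by apply: countable_bigcupT_measurable => //; exact: countableP.
by apply/seteqP; split=> w [u]; exists u.
Qed.

Lemma measurable_and_prop (d : measure_display) (T : measurableType d)
    (Q : Prop) (F : set T) :
  measurable F -> measurable [set w | Q /\ F w].
Proof.
move=> mF; have [q|nq] := pselect Q.
  by rewrite (_ : [set _ | _] = F)//; apply/seteqP; split=> [w []|w].
by rewrite (_ : [set _ | _] = set0)//; apply/seteqP; split=> [w []|w].
Qed.

Lemma measurable_open_edge (e : edge) : measurable [set w : config | w e].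
Proof. by apply: sub_sigma_algebra; exists e. Qed.

Lemma measurable_connected (x y : vertex) :
  measurable [set w : config | Defs.connected w x y].
Proof.
have mstep a b : measurable [set w : config | open_step w a b].
  rewrite (_ : [set _ | _] = [set w : config | exists e, joins e a b /\ w e]).
    apply: measurable_exists => e; apply: measurable_and_prop.
    exact: measurable_open_edge.
  apply/seteqP; split=> w.
    by move=> /asboolP[e we ej]; exists e.
  by move=> [e [ej we]]; apply/asboolP; exists e.
have mpath s : forall a, measurable [set w : config | path (open_step w) a s].
  elim: s => [|b s IH] a.
    by rewrite (_ : [set _ | _] = setT)//; apply/seteqP; split.
  rewrite (_ : [set _ | _] = [set w : config | open_step w a b] `&`
    [set w : config | path (open_step w) b s]); first exact: measurableI.
  by apply/seteqP; split=> w /= => [/andP|] [h1 h2]; rewrite ?h1 ?h2.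
rewrite (_ : [set _ | _] =
  [set w : config | exists s, last x s = y /\ path (open_step w) x s]).
  apply: measurable_exists => s; apply: measurable_and_prop.
  exact: mpath.
apply/seteqP; split=> w; first by move=> [s h1 h2]; exists s.
by move=> [s [h1 h2]]; exists s.
Qed.

Lemma measurable_connects (S1 S2 : set vertex) : measurable (connects S1 S2).
Proof.
rewrite (_ : connects S1 S2 = [set w : config | exists p : vertex * vertex,
    (S1 p.1 /\ S2 p.2) /\ Defs.connected w p.1 p.2]).
  apply: measurable_exists => p; apply: measurable_and_prop.
  exact: measurable_connected.
apply/seteqP; split=> w.
  by move=> [x [y [h1 h2 h3]]]; exists (x, y).
by move=> [[x y] [[h1 h2] h3]]; exists x, y.
Qed.

(** * Open connections and forcing edges open *)

Lemma open_step_sym (w : config) (x y : vertex) :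
  open_step w x y = open_step w y x.
Proof.
by apply/asboolP/asboolP => -[e we ej]; exists e => //; case: ej => [] [-> ->];
  [right|left|right|left].
Qed.

Lemma connected_refl (w : config) (x : vertex) : Defs.connected w x x.
Proof. by exists [::]. Qed.

Lemma connected_trans (w : config) (x y z : vertex) :
  Defs.connected w x y -> Defs.connected w y z -> Defs.connected w x z.
Proof.
move=> [s sp <-] [s' sp' <-]; exists (s ++ s'); last by rewrite last_cat.
by rewrite cat_path sp sp'.
Qed.

Lemma connected_edge (w : config) (e : edge) (x y : vertex) :
  w e -> joins e x y -> Defs.connected w x y.
Proof.
by move=> we ej; exists [:: y] => //=; rewrite andbT; apply/asboolP; exists e.
Qed.

Lemma connected_sym (w : config) (x y : vertex) :
  Defs.connected w x y -> Defs.connected w y x.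
Proof.
move=> [s]; elim: s x => [x _ <-|z s IH x /andP[xz zs] sy].
  exact: connected_refl.
apply: connected_trans (IH z zs sy) _.
by exists [:: x] => //=; rewrite andbT open_step_sym.
Qed.

Definition all_open (s : seq edge) : set config :=
  [set w | forall e, e \in s -> w e].

(** The preimage of an event under [force_open s] does not depend on the states of the edges in [s];
    this is how independence from these edges is expressed. *)
Definition force_open (s : seq edge) (w : config) : config :=
  fun e => (e \in s) || w e.

Lemma measurable_all_open (s : seq edge) : measurable (all_open s).
Proof.
by apply: (@measurable_forall_in _ config _ s (fun e w => w e)) => e _;
  exact: measurable_open_edge.
Qed.

Lemma measurable_force_open (s : seq edge) :
  measurable_fun [set: config] (force_open s : config -> config).
Proof.
apply: (@measurability _ _ config config _ _ coordinate_events) => // _ [_ [e _ <-] <-].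
rewrite setTI; case: (boolP (e \in s)) => es.
  rewrite (_ : _ @^-1` _ = setT)//; apply/seteqP; split=> // w _ /=.
  by rewrite /force_open es.
rewrite (_ : _ @^-1` _ = [set w : config | w e]).
  exact: measurable_open_edge.
by apply/seteqP; split=> w /=; rewrite /force_open (negPf es).
Qed.

Lemma all_open_cat (s s' : seq edge) :
  all_open (s ++ s') = all_open s `&` all_open s'.
Proof.
apply/seteqP; split=> w.
  by move=> h; split=> e es; apply: h; rewrite mem_cat es ?orbT.
by move=> [h h'] e; rewrite mem_cat => /orP[/h|/h'].
Qed.

Lemma all_open_force (s s' : seq edge) :
  force_open s @^-1` all_open s' = all_open [seq e <- undup s' | e \notin s].
Proof.
apply/seteqP; split=> w h e.
  rewrite mem_filter mem_undup => /andP[/negPf es /h].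
  by rewrite /force_open es.
move=> es'; rewrite /force_open; case: (boolP (e \in s)) => //= es.
by apply: h; rewrite mem_filter es mem_undup.
Qed.

(** The events [all_open s] are stable under intersection, so this makes them a generating pi-system
    on which finite measures can be compared. *)
Lemma measurable_config_all_open :
  @measurable _ config = <<s range all_open >>.
Proof.
apply/seteqP; split; apply: smallest_sub; try exact: smallest_sigma_algebra.
  move=> _ [e _ <-]; apply: sub_sigma_algebra; exists [:: e] => //.
  apply/seteqP; split=> w; first by apply; exact: mem_head.
  by move=> we f; rewrite inE => /eqP->.
by move=> _ [s _ <-]; exact: measurable_all_open.
Qed.

Lemma connected_grid (w : config) (n i j : nat) :
  all_open (comb n) w -> (i <= n)%N -> (j <= n)%N ->
  Defs.connected w origin (gpt i j).
Proof.
move=> wc; apply: (comb_ind n (Defs.connected w origin)).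
  exact: connected_refl.
move=> e x y ec exy wx; apply: connected_trans wx _.
exact: connected_edge (wc e ec) exy.
Qed.

Lemma connected_grid_endpoint (w : config) (n : nat) (e : edge) (x : vertex) :
  all_open (comb n) w -> e \in grid n -> endpoint e x ->
  Defs.connected w origin x.
Proof.
move=> wc eg ex; have [i [j [hi hj ->]]] := grid_endpoint n e x eg ex.
exact: connected_grid wc hi hj.
Qed.

(** A step along a rung can be replaced by a detour through the origin inside the open comb. *)
Lemma force_rungs_connected (w : config) (n : nat) (x y : vertex) :
  all_open (comb n) w ->
  Defs.connected (force_open (rungs n) w) x y -> Defs.connected w x y.
Proof.
move=> wc [s]; elim: s x => [x _ <-|z s IH x /andP[xz zs] sy].
  exact: connected_refl.
apply: connected_trans (IH z zs sy).
have /asboolP[e /orP[er|we] exz] := xz; last exact: connected_edge we exz.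
have eg : e \in grid n by rewrite mem_cat er orbT.
have [ex ez] := joins_endpoint e x z exz.
apply: connected_trans (connected_grid_endpoint w n e z wc eg ez).
exact/connected_sym/(connected_grid_endpoint w n e x wc eg ex).
Qed.

(** * Upper bound for the IIC *)

Section percolation.
Context (R : realType) (p : R) (mu : probability config R).
Hypothesis p01 : 0 <= p <= 1.
Hypothesis mup : bernoulli_percolation p mu.

Lemma all_open_prob (s : seq edge) :
  uniq s -> mu (all_open s) = (p ^+ size s)%:E.
Proof.
move=> us; rewrite [LHS](mup s (fun=> true) us); congr EFin.
by rewrite big_const_seq count_predT iter_mulr mulr1.
Qed.

(** As functions of [C], both sides are finite measures. On a cylinder [all_open s'] the preimage
    only concerns edges outside [s], so the powers of [p] multiply, and uniqueness of measures gives
    the rest. *)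
Lemma force_open_indep (s : seq edge) (C : set config) :
  uniq s -> measurable C ->
  (mu (all_open s `&` force_open s @^-1` C) =
  (p ^+ size s)%:E * mu (force_open s @^-1` C))%E.
Proof.
move=> us mC.
have p0 : 0 <= p ^+ size s by rewrite exprn_ge0//; case/andP: p01.
pose mf := measurable_force_open s.
pose m1 : {measure set config -> \bar R} :=
  pushforward (mrestr mu (measurable_all_open s)) (force_open s).
pose m2 : {measure set config -> \bar R} :=
  mscale (NngNum p0) (pushforward mu (force_open s)).
rewrite setIC; suff : m1 mf C = m2 mf C by [].
apply: (@measure_unique _ R config (range all_open) (fun=> setT)) => //.
- exact: measurable_config_all_open.
- move=> _ _ [s1 _ <-] [s2 _ <-]; exists (s1 ++ s2) => //.
  exact: all_open_cat.
- by move=> _; exists [::] => //; apply/seteqP; split.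
- by rewrite bigcup_const.
- move=> _ [s' _ <-]; rewrite /m1 /m2 /= /mscale /= /pushforward /mrestr.
  rewrite all_open_force setIC -all_open_cat !all_open_prob.
  + by rewrite size_cat exprD EFinM.
  + by rewrite filter_uniq// undup_uniq.
  + rewrite cat_uniq us filter_uniq ?undup_uniq// andbT.
    by apply/hasPn => e; rewrite mem_filter => /andP[].
- move=> _; rewrite /m1 /= /pushforward /mrestr preimage_setT setTI.
  exact: le_lt_trans (probability_le1 mu (measurable_all_open s)) (ltry 1).
Qed.

Lemma grid_open_connects (n : nat) (S2 : set vertex) :
  (mu (all_open (grid n) `&` connects [set origin] S2) <=
   (p ^+ (n * n))%:E * mu (connects [set origin] S2))%E.
Proof.
have mA := measurable_connects [set origin] S2.
pose C := all_open (comb n) `&` connects [set origin] S2.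
have mC : measurable C by apply: measurableI => //; exact: measurable_all_open.
have uT : uniq (rungs n).
  by have := uniq_grid n; rewrite cat_uniq => /and3P[].
have mpre : measurable (force_open (rungs n) @^-1` C).
  rewrite -[X in measurable X]setTI.
  exact: measurable_force_open.
(* When the rungs are open, forcing them open changes nothing. *)
apply: (@le_trans _ _
  (mu (all_open (rungs n) `&` force_open (rungs n) @^-1` C))).
  apply: le_measure; rewrite ?inE.
  - by apply: measurableI => //; exact: measurable_all_open.
  - by apply: measurableI => //; exact: measurable_all_open.
  rewrite all_open_cat => w [[wc wr] wS]; split=> //=.
  rewrite (_ : force_open _ w = w)//; apply/funext => e.
  by rewrite /force_open; case: (boolP (e \in _)) => // /wr ->.
rewrite force_open_indep// size_rungs; apply: lee_wpmul2l.
  by rewrite lee_fin exprn_ge0//; case/andP: p01.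
(* Comb edges are not rungs, so they are open before the forcing too, and the forced rungs create no
   new connection. *)
apply: le_measure; rewrite ?inE// => w [wc [_ [y [-> S2y wy]]]].
exists origin, y; split=> //; apply: force_rungs_connected wy => e ec.
have := wc e ec; rewrite /force_open; case: (boolP (e \in rungs n)) => // er.
by have := uniq_grid n; rewrite cat_uniq => /and3P[_ /hasPn/(_ e er)]; rewrite /= ec.
Qed.

(** The bound holds for the conditional probability at every [N], hence in the limit. *)
Lemma iic_grid_open (nu : probability config R) (n : nat) :
  iic_measure mu nu -> (nu (all_open (grid n)) <= (p ^+ (n * n))%:E)%E.
Proof.
move=> hnu; have fd : finitely_determined (all_open (grid n)).
  by exists (grid n) => w w' ww' h e eg; have := ww' e eg;
    rewrite /open_edge => <-; exact: h.
have p0 : 0 <= p ^+ (n * n) by rewrite exprn_ge0//; case/andP: p01.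
have fin (Q : probability config R) A : measurable A -> Q A \is a fin_num.
  by move=> mA; exact: fin_num_measure.
have mG := measurable_all_open (grid n).
rewrite -(fineK (fin nu _ mG)) lee_fin.
apply: (cvgr_to_le (hnu _ fd)); apply: nearW => N; rewrite /= /cond_prob.
set A := connects _ _.
have mA : measurable A by exact: measurable_connects.
have : (fine (mu (all_open (grid n) `&` A)) <= p ^+ (n * n) * fine (mu A)).
  rewrite -lee_fin EFinM !fineK ?fin//; last exact: measurableI.
  exact: grid_open_connects.
have : 0 <= fine (mu A) by exact: fine_ge0.
(* If the conditioning event is null, [cond_prob] is 0 since division by zero gives 0. *)
rewrite le_eqVlt => /predU1P[<- _|A0 h]; first by rewrite invr0 mulr0.
by rewrite ler_pdivrMr.
Qed.

End percolation.

(** * Uniform weights and the lower bound for the IPC *)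

Lemma prode_const_seq (R : realType) (U : eqType) (s : seq U)
    (F : U -> \bar R) (x : R) :
  (forall u, u \in s -> F u = x%:E) ->
  (\prod_(u <- s) F u = (x ^+ size s)%:E)%E.
Proof.
elim: s => [|u s IH] Fx; first by rewrite big_nil.
rewrite big_cons Fx ?mem_head// IH; first by rewrite -EFinM -exprS.
by move=> v vs; apply: Fx; rewrite inE vs orbT.
Qed.

Lemma uniform_prob_itv (R : realType) (q : R) : 0 <= q <= 1 ->
  uniform_prob (@ltr01 R) `]-oo, q] = q%:E /\
  uniform_prob (@ltr01 R) `]q, +oo[ = (1 - q)%:E.
Proof.
move=> /andP[q0 q1].
have E (A : set R) (mA : measurable A) : uniform_prob (@ltr01 R) A =
    lebesgue_measure (A `&` `[0, 1]).
  rewrite /uniform_prob integral_uniform_pdf.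
  rewrite (eq_integral (fun=> 1%E)).
    rewrite integral_cst ?mul1e//; exact: measurableI.
  move=> x; rewrite inE => -[_]; rewrite /= in_itv/= /uniform_pdf => ->.
  by rewrite subr0 invr1.
split; rewrite E//.
  rewrite (_ : _ `&` _ = `[0, q]%classic).
    rewrite lebesgue_measure_itv/= lte_fin.
    case: ltP => [_|h]; first by rewrite sube0.
    by congr EFin; lra.
  by apply/seteqP; split=> x /=; rewrite !in_itv/=; lra.
rewrite (_ : _ `&` _ = `]q, 1]%classic).
  rewrite lebesgue_measure_itv/= lte_fin.
  case: ltP => [_//|h].
  by congr EFin; lra.
by apply/seteqP; split=> x /=; rewrite !in_itv/=; lra.
Qed.

Section invasion_law.
Context (R : realType) (d : measure_display) (T : measurableType d)
  (P : probability T R) (tau : edge -> {RV P >-> R}).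

Lemma measurable_map_bool (U : Type) (b : U -> T -> bool) (s : seq U) :
  (forall u, measurable [set w | b u w]) ->
  forall l : seq bool, measurable [set w | [seq b u w | u <- s] = l].
Proof.
move=> mb; elim: s => [|u s IH] [|x l] /=.
- by rewrite (_ : [set _ | _] = setT)//; apply/seteqP; split.
- by rewrite (_ : [set _ | _] = set0)//; apply/seteqP; split.
- by rewrite (_ : [set _ | _] = set0)//; apply/seteqP; split.
rewrite (_ : [set _ | _] =
  [set w | b u w = x] `&` [set w | [seq b u w | u <- s] = l]).
  apply: measurableI => //; case: x; first exact: mb.
  rewrite (_ : [set _ | _] = ~` [set w | b u w]); first exact: measurableC.
  by apply/seteqP; split=> w /=; [move->|move/negP/negPf].
by apply/seteqP; split=> w /= [-> ->].
Qed.

(** By locality the graph is determined by a finite vector of comparisons [c w]. The event is a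
    countable union over the values of this vector, so [Q] may be any set of graphs. *)
Lemma measurable_invasion (k : nat) (Q : set graph) :
  measurable [set w | Q (invasion (tau^~ w) k)].
Proof.
have [s sP] := invasion_local R k.
pose b (u : edge * edge) w := tau u.1 w <= tau u.2 w.
pose c w := [seq b u w | u <- [seq (e, f) | e <- s, f <- s]].
rewrite (_ : [set _ | _] = [set w | exists l,
    (exists2 w', c w' = l & Q (invasion (tau^~ w') k)) /\ c w = l]).
  apply: measurable_exists => l; apply: measurable_and_prop.
  apply: measurable_map_bool => -[e f].
  rewrite -[X in measurable X]setTI.
  have : measurable_fun setT (b (e, f)) by exact: measurable_realfun.measurable_fun_ler.
  by move=> /(_ measurableT [set true]); apply.
apply/seteqP; split=> [w Qw|w [_ [[w' <- Qw'] /eq_in_map h]]] /=.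
  by exists (c w); split=> //; exists w.
rewrite (sP _ (tau^~ w'))// => e f es fs.
by apply: (h (e, f)); apply/allpairsP; exists (e, f).
Qed.

Lemma measurable_invasion_cluster (s : seq edge) :
  measurable [set w | forall e, e \in s ->
    eset (invasion_cluster (fun e => tau e w)) e].
Proof.
apply: (@measurable_forall_in _ T _ s
  (fun e w => eset (invasion_cluster (fun e => tau e w)) e)) => e _.
rewrite (_ : (fun w => _) =
  [set w | exists k, eset (invasion (tau^~ w) k) e]).
  apply: measurable_exists => k.
  exact: (measurable_invasion k (fun g => eset g e)).
by apply/seteqP; split=> w; [move=> [k _ h]; exists k|move=> [k h]; exists k].
Qed.

Lemma invasion_grid_prob (n : nat) (q : R) : iid_uniform tau -> 0 <= q <= 1 ->
  ((q ^+ size (grid n) * (1 - q) ^+ size (frame n))%:E <=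
   P [set w | forall e, e \in grid n ->
       eset (invasion_cluster (fun e => tau e w)) e])%E.
Proof.
move=> [tau_unif tau_indep] q01.
(* Light on the grid and heavy on the frame: by independence this event has exactly the probability
   on the left, and it makes the invasion fill the grid. *)
pose B e : set R := if e \in grid n then `]-oo, q]%classic else `]q, +oo[%classic.
have mB e : measurable (B e) by rewrite /B; case: ifP.
have [uq uq'] := uniform_prob_itv R q q01.
have := tau_indep (grid n ++ frame n) B (uniq_grid_frame n) mB.
rewrite big_cat/= (prode_const_seq _ _ _ _ q); last first.
  by move=> e eg; have := tau_unif e (B e) (mB e); rewrite /B eg uq.
rewrite (prode_const_seq _ _ _ _ (1 - q)); last first.
  move=> e ef; have := tau_unif e (B e) (mB e); rewrite /B ifN ?uq'//.
  by have := uniq_grid_frame n; rewrite cat_uniq => /and3P[_ /hasPn/(_ e ef)].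
rewrite EFinM => <-; apply: le_measure; rewrite ?inE.
- apply: (@measurable_forall_in _ T _ _ (fun e w => B e (tau e w))) => e _.
  by rewrite -[X in measurable X]setTI; exact: measurable_funPT.
- exact: measurable_invasion_cluster.
move=> w wB; have [||k kE] := @invasion_fills_grid R (tau^~ w) q n.
- move=> e eg; have := wB e; rewrite mem_cat eg => /(_ isT).
  by rewrite /B eg /= in_itv.
- move=> e ef; have := wB e; rewrite mem_cat ef orbT => /(_ isT).
  rewrite /B ifN /= ?in_itv/= ?andbT//.
  by have := uniq_grid_frame n; rewrite cat_uniq => /and3P[_ /hasPn/(_ e ef)].
by move=> e eg; exists k => //; exact: kE.
Qed.

End invasion_law.

(** * Comparison of the two bounds, and the coupling *)

Lemma square_beats_linear (R : realType) (p : R) : 0 < p < 1 ->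
  exists n : nat, exists2 q : R, 0 <= q <= 1 &
    p ^+ (n * n) < q ^+ (2 * n * n.+1) * (1 - q) ^+ (4 * n.+1).
Proof.
move=> /andP[p0 p1]; pose q : R := (1 + p) / 2.
have q0 : 0 < q by rewrite /q; lra.
have q1 : q < 1 by rewrite /q; lra.
(* The difference is the square of [(1 - p) / 2]. *)
have pq : p < q ^+ 2 by rewrite /q expr2; nra.
pose r := p / q ^+ 2.
have r0 : 0 < r by rewrite divr_gt0 ?exprn_gt0.
have r1 : r < 1 by rewrite ltr_pdivrMr ?exprn_gt0// mul1r.
have q'0 : 0 < 1 - q by lra.
(* With [m] steps per side, division by [q ^+ (2 * m * m)] leaves [r ^+ (m * m)] against
   [q ^+ (2 * m) * (1 - q) ^+ (4 * m.+1)]. For [m] at least 1, [4 * m.+1] is at most [8 * m], so the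
   latter is at least [c ^+ m] and [r ^+ m < c] suffices. *)
pose c := q ^+ 2 * (1 - q) ^+ 8.
have c0 : 0 < c by rewrite mulr_gt0 ?exprn_gt0.
have [n rn] : exists n, r ^+ n.+1 < c.
  have r1' : `|r| < 1 by rewrite gtr0_norm.
  have /cvgrPdist_lt/(_ c c0)[N _ NP] := cvg_expr r1'.
  exists N; have := NP N.+1 (leqnSn N).
  by rewrite /= sub0r normrN gtr0_norm// exprn_gt0.
exists n.+1, q; first by rewrite !ltW.
set m := n.+1 in rn *.
have -> : p ^+ (m * m) = q ^+ (2 * m * m) * (r ^+ m) ^+ m.
  rewrite -mulnA !exprM -exprMn /r; congr (_ ^+ m).
  by rewrite -exprMn mulrC divfK// expf_neq0// gt_eqF.
have -> : (2 * m * m.+1 = 2 * m * m + 2 * m)%N by lia.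
rewrite exprD -mulrA ltr_pM2l ?exprn_gt0//.
apply: (@lt_le_trans _ _ (c ^+ m)).
  by rewrite ltrXn2r// ltW// exprn_gt0.
rewrite /c exprMn -!exprM ler_pM2l ?exprn_gt0//.
rewrite ler_wiXn2l//; try lra.
by rewrite /m; lia.
Qed.

(** An edge of the cluster must also have its endpoints connected to the origin; the open comb
    provides this. *)
Lemma cluster_graph_grid (n : nat) :
  cluster_graph @^-1` [set g | forall e, e \in grid n -> eset g e] =
  all_open (grid n).
Proof.
apply/seteqP; split=> w wg e eg; first by have [] := wg e eg.
split=> [|y ey]; first exact: wg.
apply: connected_grid_endpoint eg ey => f fc.
by apply: wg; rewrite mem_cat fc.
Qed.

Theorem theorem1 (R : realType)
  (d0 : measure_display) (T0 : measurableType d0) (P0 : probability T0 R)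
  (tau : edge -> {RV P0 >-> R}) (htau : iid_uniform tau)
  (Pp : R -> probability config R)
  (hPp : forall p : R, 0 <= p <= 1 -> bernoulli_percolation p (Pp p))
  (pc : R) (hpc : critical_probability Pp pc)
  (nu : probability config R) (hnu : iic_measure (Pp pc) nu) :
  ~ exists (d : measure_display) (T : measurableType d)
      (P : probability T R) (I J : {RV P >-> subgraph}),
      [/\ has_law_of I P0 (fun w => invasion_cluster (fun e => tau e w)),
          has_law_of J nu cluster_graph &
          {ae P, forall w, subgraph_of (I w) (J w)}].
Proof.
case: hpc => pc01 _ [d [T [P [I [J [Ilaw Jlaw IJ]]]]]].
have pc01' : 0 <= pc <= 1 by case/andP: pc01 => /ltW-> /ltW->.
have [n [q q01 npq]] := square_beats_linear R pc pc01.
pose A : set subgraph := [set g | forall e, e \in grid n -> eset g e].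
have mA : measurable A.
  apply: (@measurable_forall_in _ subgraph _ (grid n) (fun e g => eset g e)).
  by move=> e _; apply: sub_sigma_algebra; right; exists e.
have mI : measurable (I @^-1` A).
  by rewrite -[X in measurable X]setTI; exact: measurable_funPT.
have mJ : measurable (J @^-1` A).
  by rewrite -[X in measurable X]setTI; exact: measurable_funPT.
(* [A] is increasing in the graph, so outside the null set [N] it passes from [I w] to [J w]. *)
have leIJ : (P (I @^-1` A) <= P (J @^-1` A))%E.
  have [N [mN N0 sN]] := IJ.
  rewrite -(measureU0 mJ mN N0); apply: le_measure; rewrite ?inE//.
    exact: measurableU.
  move=> w Iw; have [Nw|nNw] := pselect (N w); [by right|left].
  have [_ sE] : subgraph_of (I w) (J w).
    by apply: contrapT => nIJ; exact/nNw/sN.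
  by move=> e eg; exact/sE/Iw.
(* The equality of laws moves the lower bound to [I] and the upper bound to [J]; the choice of [n]
   and [q] makes them contradict [leIJ]. *)
have := invasion_grid_prob R _ _ P0 tau n q htau q01.
have -> : P0 [set w | forall e, e \in grid n ->
    eset (invasion_cluster (fun e => tau e w)) e] = P (I @^-1` A).
  by rewrite -[RHS]/(distribution P I A) Ilaw.
rewrite leNgt => /negP; apply; apply: le_lt_trans leIJ _.
rewrite -[P _]/(distribution P J A) Jlaw// cluster_graph_grid.
apply: le_lt_trans (iic_grid_open R pc _ pc01' (hPp pc pc01') nu n hnu) _.
by rewrite lte_fin size_grid size_frame.
Qed.
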